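(* Let $m$ be a nonnegative integer and $0<q<1$. Then $$\left(\sum_{n=-\infty}^\infty(-1)^nq^{n^2}\right)^{2m+2}=1+2\sum_{n=1}^\infty(-1)^n\;{}_{m+2}\phi_{m+1}\left({q^{-n},q^n,q,\dots,q\atop -q,-q,\dots,-q};q,q\right),$$ where in the ${}_{m+2}\phi_{m+1}$ the upper parameters are $q^{-n},q^n$ followed by $m$ copies of $q$, and the lower parameters are $m+1$ copies of $-q$.
   Context: Put $(x;q)_0=1$, $(x;q)_k=\prod_{i=0}^{k-1}(1-xq^i)$. For a nonnegative integer $n$, the terminating basic hypergeometric series is $${}_{r+1}\phi_r\left({q^{-n},a_2,\dots,a_{r+1}\atop b_1,\dots,b_r};q,z\right)=\sum_{k=0}^n\frac{(q^{-n};q)_k(a_2;q)_k\cdots(a_{r+1};q)_k}{(q;q)_k(b_1;q)_k\cdots(b_r;q)_k}z^k .$$ *)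

(* Defs.v *)
From mathcomp Require Import all_boot all_order all_algebra.
From mathcomp Require Import all_classical all_reals all_analysis.

Set Implicit Arguments.
Unset Strict Implicit.
Unset Printing Implicit Defensive.

Import Order.TTheory GRing.Theory Num.Theory.
Import numFieldNormedType.Exports.

Local Open Scope classical_set_scope.
Local Open Scope ring_scope.

Definition qpoch (R : pzRingType) (x q : R) (k : nat) : R :=
  \prod_(i < k) (1 - x * q ^+ i).

(* The terminating series {r+1}phi{r}: the upper parameter q^(-n) is built in,
   [a] lists the remaining upper parameters a_2, ..., a_(r+1), and [b] the lower
   parameters b_1, ..., b_r. *)
Definition qhyper (R : fieldType) (r n : nat) (a b : r.-tuple R) (q z : R) : R :=
  \sum_(k < n.+1)
    (qpoch (q ^- n) q k * \prod_(x <- a) qpoch x q k)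
      / (qpoch q q k * \prod_(y <- b) qpoch y q k) * z ^+ k.

(* A two-sided series converges when its parts over n >= 0 and over n < 0 both
   converge; its value is then the sum of the two limits. *)
Definition bilateral_cvg (R : realType) (f : int -> R) : Prop :=
  cvgn (series (fun n : nat => f n%:Z)) /\
  cvgn (series (fun n : nat => f (- n.+1%:Z))).

Definition bilateral_sum (R : realType) (f : int -> R) : R :=
  limn (series (fun n : nat => f n%:Z)) +
  limn (series (fun n : nat => f (- n.+1%:Z))).

(* Main.v *)
Require Import Defs.
From mathcomp Require Import all_boot all_order all_algebra.
From mathcomp Require Import all_classical all_reals all_analysis.
From mathcomp Require Import ring lra.

Set Implicit Arguments.
Unset Strict Implicit.
Unset Printing Implicit Defensive.

Import Order.TTheory GRing.Theory Num.Theory.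
Import numFieldNormedType.Exports.

Local Open Scope classical_set_scope.
Local Open Scope ring_scope.

(** Write x = q^k.  Since (q)_k / (-q)_k is the value at x of
    G(x) = theta * (-qx; q)_oo / (qx; q)_oo with theta = (q)_oo / (-q)_oo,
    the right-hand side is f(1) + 2 sum_(n >= 1) (-1)^n phi_n(f) with
    f = G^(m+1) and
      phi_n(f) = sum_(k <= n) (q^-n)_k (q^n)_k / (q)_k^2 * q^k * f(q^k).
    The proposition is an instance of the principle
      f(1) + 2 sum_(n >= 1) (-1)^n phi_n(f) = f(-1),
    i.e. the alternating sum evaluates f at x = -1, a point outside the set of
    the q^k, for every f whose Taylor coefficients decay fast enough.  Here
    G(-1) = theta^2.  The choice f = (q)_oo / (qx; q)_oo has phi_n(f) = q^(n^2)
    and f(-1) = theta, which is the formula of Gauss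
    sum_n (-1)^n q^(n^2) = theta; so the left-hand side is theta^(2m+2) too.

    The principle rests on a telescoping.  If psi_n is phi_n with q^n replaced
    by q^(n+1) in the second Pochhammer symbol, then
      phi_n((1 + x) f) = psi_n(f) + psi_(n-1)(f),
    so the N-th partial sum S_N satisfies S_N((1 + x) f) = 2 (-1)^N psi_N(f)
    ([alt_sum_psi]).  Now psi_N(x^i) is a little q-Legendre polynomial at q^i,
    bounded by A r^N / r^i for any r strictly between q and 1
    ([psi_sum_monomial_bound]).  From S_N(1) = 1 and
    S_N(x^(i+1)) = 2 (-1)^N psi_N(x^i) - S_N(x^i), an induction on i yields
    |S_N(x^i) - (-1)^i| <= A' r^N / r^i, and this kind of bound survives
    multiplication by a power series sum_j h_j x^j with sum_j |h_j| / r^j finite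
    ([converges_to_evalm1_series]).  The q-binomial theorem writes (q)_k / (aq)_k
    as such a series in q^k, for a = -1 and for a = 0 (the case of Gauss), and
    its value at x = -1 is theta^2, respectively theta
    ([qbin_ratio_m1]). *)

(** * Shifted factorials *)

Section Pochhammer.
Variables (R : comPzRingType) (q : R).

Lemma qpoch0 x : qpoch x q 0 = 1.
Proof. by rewrite /qpoch big_ord0. Qed.

Lemma qpochSr x k : qpoch x q k.+1 = qpoch x q k * (1 - x * q ^+ k).
Proof. by rewrite /qpoch big_ord_recr. Qed.

Lemma qpochSl x k : qpoch x q k.+1 = (1 - x) * qpoch (x * q) q k.
Proof.
rewrite /qpoch big_ord_recl expr0 mulr1; congr (_ * _).
by apply: eq_bigr => i _; rewrite /bump /= exprS mulrA.
Qed.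

Lemma qpochD x m n : qpoch x q (m + n) = qpoch x q m * qpoch (x * q ^+ m) q n.
Proof.
elim: n => [|n IHn]; first by rewrite addn0 qpoch0 mulr1.
by rewrite addnS !qpochSr IHn exprD !mulrA.
Qed.

Lemma qpoch_zero n : qpoch 0 q n = 1.
Proof. by rewrite /qpoch big1 // => i _; rewrite mul0r subr0. Qed.

End Pochhammer.

Section FixedBase.
Variables (R : realType) (q : R).
Hypotheses (q_gt0 : 0 < q) (q_lt1 : q < 1).

Let q_neq0 : q != 0. Proof. by rewrite gt_eqF. Qed.
Let q_ge0 : 0 <= q. Proof. exact: ltW. Qed.
Let q_le1 : q <= 1. Proof. exact: ltW. Qed.

Lemma onem_expr_gt0 k : 0 < 1 - q ^+ k.+1.
Proof. by rewrite subr_gt0 exprn_ilt1. Qed.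

Lemma qpoch_gt0 n : 0 < qpoch q q n.
Proof.
by rewrite /qpoch prodr_gt0 // => i _; rewrite -exprS onem_expr_gt0.
Qed.

Lemma qpoch_neq0 n : qpoch q q n != 0.
Proof. by rewrite gt_eqF ?qpoch_gt0. Qed.

Lemma qpoch_qVn_vanish n : qpoch (q ^- n) q n.+1 = 0.
Proof. by rewrite qpochSr mulVf ?expf_neq0// subrr mulr0. Qed.

(** * The n-th q-difference at the points 1, q, q^2, ... *)

(** Up to normalisation, the divided difference of f at 1, q, ..., q^n, where
    f k stands for the value at q^k; it is the product over l < n of the
    operators 1 - q^-l E, E being the shift of k. *)
Definition qdiff (n : nat) (f : nat -> R) : R :=
  \sum_(k < n.+1) qpoch (q ^- n) q k / qpoch q q k * q ^+ k * f k.

Lemma qdiff0 f : qdiff 0 f = f 0%N.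
Proof. by rewrite /qdiff big_ord1 !qpoch0 divr1 !mul1r. Qed.

Lemma qdiffS n f :
  qdiff n.+1 f = qdiff n f - q ^- n * qdiff n (fun k => f k.+1).
Proof.
have -> : qdiff n f =
    \sum_(k < n.+2) qpoch (q ^- n) q k / qpoch q q k * q ^+ k * f k.
  by rewrite big_ord_recr /= qpoch_qVn_vanish !mul0r addr0.
rewrite /qdiff !(big_ord_recl n.+1) /= !qpoch0 -addrA; congr (_ + _).
rewrite mulr_sumr -sumrB; apply: eq_bigr => i _; rewrite /bump /= add1n.
rewrite [qpoch (q ^- n.+1) _ _]qpochSl [qpoch (q ^- n) _ _]qpochSr.
have -> : q ^- n.+1 * q = q ^- n by rewrite exprS invfM mulrAC mulVf ?mul1r.
rewrite [qpoch q q i.+1]qpochSr -exprS.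
have h1 := qpoch_neq0 i; have h2 := onem_expr_gt0 i.
have {h2}h2 : 1 - q ^+ i.+1 != 0 by rewrite gt_eqF.
have h3 : q ^+ n != 0 by rewrite expf_neq0.
move: h2; rewrite !exprS => h2; field.
by rewrite h1 h2 h3 q_neq0.
Qed.

Lemma eq_qdiff n f g : (forall k, f k = g k) -> qdiff n f = qdiff n g.
Proof. by move=> fg; apply: eq_bigr => k _; rewrite fg. Qed.

Lemma qdiffB n f g : qdiff n (fun k => f k - g k) = qdiff n f - qdiff n g.
Proof. by rewrite -sumrB; apply: eq_bigr => k _; rewrite mulrBr. Qed.

Lemma qdiffZ n c f : qdiff n (fun k => c * f k) = c * qdiff n f.
Proof. by rewrite mulr_sumr; apply: eq_bigr => k _; rewrite mulrCA. Qed.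

(** The q-Chu-Vandermonde sum with lower parameter 0. *)
Lemma qdiff_qpoch n b : qdiff n (qpoch b q) = b ^+ n.
Proof.
elim: n b => [|n IHn] b; first by rewrite qdiff0 qpoch0.
rewrite qdiffS IHn.
rewrite (@eq_qdiff _ (fun k => qpoch b q k.+1) (fun k => (1 - b) * qpoch (b * q) q k)).
  rewrite qdiffZ IHn exprMn exprS.
  have h3 : q ^+ n != 0 by rewrite expf_neq0.
  by field.
by move=> k; rewrite qpochSl.
Qed.

Lemma qdiff_monomial n i :
  qdiff n (fun k => q ^+ (k * i)) = \prod_(l < n) (1 - q ^+ i / q ^+ l).
Proof.
elim: n => [|n IHn]; first by rewrite qdiff0 big_ord0.
rewrite qdiffS.
rewrite (@eq_qdiff _ (fun k => q ^+ (k.+1 * i)) (fun k => q ^+ i * q ^+ (k * i))).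
  by rewrite qdiffZ big_ord_recr /= IHn mulrBr mulr1 mulrA mulrC [_ / _]mulrC.
by move=> k; rewrite mulSn exprD.
Qed.

Lemma qdiff_monomial_small n i :
  (i < n)%N -> qdiff n (fun k => q ^+ (k * i)) = 0.
Proof.
move=> lt_in; rewrite qdiff_monomial (bigD1 (Ordinal lt_in)) //=.
by rewrite divff ?expf_neq0 // subrr mul0r.
Qed.

Lemma qdiff_monomial_itv n i :
  (n <= i)%N -> 0 <= qdiff n (fun k => q ^+ (k * i)) <= 1.
Proof.
move=> le_ni; rewrite qdiff_monomial.
have h (l : 'I_n) : 0 <= 1 - q ^+ i / q ^+ l <= 1.
  rewrite gerBl divr_ge0 ?exprn_ge0 // andbT subr_ge0 ler_pdivrMr ?exprn_gt0 //.
  by rewrite mul1r ler_wiXn2l // ltnW // (leq_trans (ltn_ord l)).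
apply: (big_ind (fun x : R => 0 <= x <= 1)) => //; first by rewrite ler01 lexx.
by move=> x y /andP[x0 x1] /andP[y0 y1]; rewrite mulr_ge0 ?mulr_ile1.
Qed.

(** In the variable x = q^k the argument is x^i (qx; q)_M, a polynomial of
    degree i + M; moments with M close to n are what the sums below reduce to. *)
Definition factorial_moment (n i M : nat) : R :=
  qdiff n (fun k => q ^+ (k * i) * qpoch (q ^+ k.+1) q M).

Lemma factorial_moment0 n i :
  factorial_moment n i 0 = qdiff n (fun k => q ^+ (k * i)).
Proof. by apply: eq_qdiff => k; rewrite qpoch0 mulr1. Qed.

Lemma factorial_momentS n i M :
  factorial_moment n i M.+1 =
  factorial_moment n i M - q ^+ M.+1 * factorial_moment n i.+1 M.
Proof.
rewrite /factorial_moment -qdiffZ -qdiffB; apply: eq_qdiff => k.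
by rewrite qpochSr mulnS exprD !exprS; ring.
Qed.

(** A divided difference of order n kills the polynomials of degree less
    than n. *)
Lemma factorial_moment_vanish n i M : (i + M < n)%N -> factorial_moment n i M = 0.
Proof.
elim: M i => [|M IHM] i.
  by rewrite addn0 => lt_in; rewrite factorial_moment0 qdiff_monomial_small.
move=> lt_n; rewrite factorial_momentS !IHM ?mulr0 ?subr0 //; first by rewrite addSnnS.
by rewrite (leq_trans _ lt_n) // ltnS leq_add2l.
Qed.

(** Both sides are (q)_(n+k) / ((q)_n (q)_k).  This turns the parameter q^(n+1),
    which involves the index n of the sum, into a polynomial in q^k. *)
Lemma qpoch_shift n k :
  qpoch (q ^+ n.+1) q k / qpoch q q k = qpoch (q ^+ k.+1) q n / qpoch q q n.
Proof.
apply/eqP; rewrite eqr_div ?qpoch_neq0 //; apply/eqP.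
by rewrite mulrC !exprS -qpochD addnC qpochD mulrC.
Qed.

(** * The sums phi_n and psi_n and the telescoping between them *)

Definition phi_coef (n k : nat) : R :=
  qpoch (q ^- n) q k * qpoch (q ^+ n) q k / qpoch q q k ^+ 2 * q ^+ k.

Definition psi_coef (n k : nat) : R :=
  qpoch (q ^- n) q k * qpoch (q ^+ n.+1) q k / qpoch q q k ^+ 2 * q ^+ k.

(** With y = q^(n+1), moving a factor from one end of (y)_k or (1/y)_k to the
    other reduces this to
    (1 - y q^k) / (1 - y) + (1 - q^k / y) / (1 - 1/y) = 1 + q^k. *)
Lemma phi_psi_coef n k :
  phi_coef n.+1 k * (1 + q ^+ k) = psi_coef n.+1 k + psi_coef n k.
Proof.
set y := q ^+ n.+1; set x := q ^- n.+1.
have y0 : y != 0 by rewrite expf_neq0.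
have y1 : 1 - y != 0 by rewrite gt_eqF // onem_expr_gt0.
have yx : x = y^-1 by [].
have x1 : 1 - x != 0 by rewrite yx subr_eq0 eq_sym invr_eq1 eq_sym -subr_eq0.
have hy : qpoch (y * q) q k = qpoch y q k * (1 - y * q ^+ k) / (1 - y).
  by rewrite -qpochSr qpochSl mulrAC mulfV // mul1r.
have hx : qpoch (x * q) q k = qpoch x q k * (1 - x * q ^+ k) / (1 - x).
  by rewrite -qpochSr qpochSl mulrAC mulfV // mul1r.
rewrite /phi_coef /psi_coef -/x -/y.
have -> : q ^+ n.+2 = y * q by rewrite exprSr.
have -> : q ^- n = x * q.
  by rewrite /x exprS invfM mulrAC mulVf ?mul1r.
rewrite hx hy; have := qpoch_neq0 k.
move: (qpoch q q k) (qpoch x q k) (qpoch y q k) => c a b c0.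
have x1' : y - 1 != 0 by rewrite -oppr_eq0 opprB.
by rewrite yx; field; rewrite c0 y1 y0 x1'.
Qed.

Definition phi_sum (n : nat) (f : nat -> R) : R :=
  \sum_(k < n.+1) phi_coef n k * f k.

Definition psi_sum (n : nat) (f : nat -> R) : R :=
  \sum_(k < n.+1) psi_coef n k * f k.

Lemma sum_factorial_moment n i M :
  \sum_(k < n.+1) qpoch (q ^- n) q k * qpoch (q ^+ M.+1) q k
      / qpoch q q k ^+ 2 * q ^+ k * q ^+ (k * i)
  = factorial_moment n i M / qpoch q q M.
Proof.
rewrite /factorial_moment /qdiff mulr_suml; apply: eq_bigr => k _.
have := qpoch_shift M k; have := qpoch_neq0 k.
move: (qpoch q q k) => c c0 /(canRL (mulfVK c0)) ->.
have := qpoch_neq0 M; move: (qpoch q q M) => d d0.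
by field; rewrite c0 d0.
Qed.

Lemma psi_sum_monomial n i :
  psi_sum n (fun k => q ^+ (k * i)) = factorial_moment n i n / qpoch q q n.
Proof. exact: sum_factorial_moment. Qed.

(** A divided difference of order n + 1 of a polynomial of degree n. *)
Lemma phi_sum_one n : phi_sum n.+1 (fun => 1) = 0.
Proof.
have -> : phi_sum n.+1 (fun => 1) = factorial_moment n.+1 0 n / qpoch q q n.
  by rewrite -sum_factorial_moment; apply: eq_bigr => k _; rewrite muln0 expr0.
by rewrite factorial_moment_vanish ?add0n // mul0r.
Qed.

(** The parameters q^n contribute (q^n)^n by q-Chu-Vandermonde: the powers
    q^(n^2) of the theta series arise in this way. *)
Lemma phi_sum_qpoch n : phi_sum n.+1 (qpoch q q) = q ^+ (n.+1 ^ 2).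
Proof.
rewrite -mulnn exprM -qdiff_qpoch; apply: eq_bigr => k _.
by rewrite /phi_coef; have := qpoch_neq0 k => k0; field.
Qed.

Lemma phi_psi_sum n (f : nat -> R) :
  phi_sum n.+1 (fun k => (1 + q ^+ k) * f k) = psi_sum n.+1 f + psi_sum n f.
Proof.
have -> : psi_sum n f = \sum_(k < n.+2) psi_coef n k * f k.
  by rewrite big_ord_recr /= /psi_coef qpoch_qVn_vanish !mul0r addr0.
rewrite -big_split; apply: eq_bigr => k _ /=.
by rewrite mulrA phi_psi_coef mulrDl.
Qed.

(** By the symmetry of phi_n under n -> -n, this is the sum over |n| <= N of
    (-1)^n phi_n(f). *)
Definition alt_sum (N : nat) (f : nat -> R) : R :=
  f 0%N + 2 * \sum_(1 <= n < N.+1) (-1) ^+ n * phi_sum n f.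

Lemma alt_sum0 f : alt_sum 0 f = f 0%N.
Proof. by rewrite /alt_sum big_geq // mulr0 addr0. Qed.

Lemma alt_sumS N f :
  alt_sum N.+1 f = alt_sum N f + 2 * ((-1) ^+ N.+1 * phi_sum N.+1 f).
Proof. by rewrite /alt_sum big_nat_recr //= mulrDr addrA. Qed.

(** The terms (-1)^n (psi_n + psi_(n-1)) telescope. *)
Lemma alt_sum_psi N (f : nat -> R) :
  alt_sum N (fun k => (1 + q ^+ k) * f k) = 2 * (-1) ^+ N * psi_sum N f.
Proof.
elim: N => [|N IHN].
  by rewrite alt_sum0 /psi_sum big_ord1 /psi_coef !qpoch0; field.
by rewrite alt_sumS IHN phi_psi_sum exprS; ring.
Qed.

Lemma eq_alt_sum N f g : (forall k, f k = g k) -> alt_sum N f = alt_sum N g.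
Proof. by move=> fg; congr (alt_sum N _); apply/funext. Qed.

Lemma alt_sumD N f g : alt_sum N (fun k => f k + g k) = alt_sum N f + alt_sum N g.
Proof.
elim: N => [|N IHN]; first by rewrite !alt_sum0.
rewrite !alt_sumS IHN.
have -> : phi_sum N.+1 (fun k => f k + g k) = phi_sum N.+1 f + phi_sum N.+1 g.
  by rewrite -big_split; apply: eq_bigr => k _; rewrite mulrDr.
by ring.
Qed.

Lemma alt_sumZ N c f : alt_sum N (fun k => c * f k) = c * alt_sum N f.
Proof.
elim: N => [|N IHN]; first by rewrite !alt_sum0.
rewrite !alt_sumS IHN.
have -> : phi_sum N.+1 (fun k => c * f k) = c * phi_sum N.+1 f.
  by rewrite mulr_sumr; apply: eq_bigr => k _; rewrite mulrCA.
by ring.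
Qed.

Lemma alt_sum_one N : alt_sum N (fun => 1) = 1.
Proof.
elim: N => [|N IHN]; first by rewrite alt_sum0.
by rewrite alt_sumS IHN phi_sum_one !mulr0 addr0.
Qed.

Lemma alt_sum_monomialS N i :
  alt_sum N (fun k => q ^+ (k * i.+1)) =
  2 * (-1) ^+ N * psi_sum N (fun k => q ^+ (k * i))
  - alt_sum N (fun k => q ^+ (k * i)).
Proof.
rewrite -alt_sum_psi; apply/eqP; rewrite eq_sym subr_eq -alt_sumD; apply/eqP.
by apply: eq_alt_sum => k; rewrite mulnS exprD; ring.
Qed.

(** * Uniform bounds on shifted factorials *)

(** Past an index M with q^M <= (1 - q) / 2, the inequality
    prod (1 - x_i) >= 1 - sum x_i loses at most a factor 2. *)
Lemma qpoch_lower_bound : exists2 c, 0 < c & forall n, c <= qpoch q q n.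
Proof.
have q1 : 0 < 1 - q by rewrite subr_gt0.
have [M qM] : exists M, q ^+ M <= (1 - q) / 2.
  have q_norm : `|q| < 1 by rewrite ger0_norm.
  have e0 : 0 < (1 - q) / 2 by rewrite divr_gt0.
  have /cvgr0Pnorm_le/(_ _ e0)[M _ /(_ M (leqnn M))/= hM] := cvg_expr q_norm.
  by exists M; rewrite (le_trans (ler_norm _)).
have step n : qpoch q q M * (1 - (q ^+ M.+1 - q ^+ (M + n).+1) / (1 - q))
              <= qpoch q q (M + n).
  elim: n => [|n IHn]; first by rewrite addn0 subrr mul0r subr0 mulr1.
  rewrite addnS qpochSr -exprS.
  have x1 := onem_expr_gt0 (M + n).
  apply: le_trans (ler_wpM2r (ltW x1) IHn).
  rewrite -mulrA ler_wpM2l ?(ltW (qpoch_gt0 _)) //.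
  have -> : 1 - (q ^+ M.+1 - q ^+ (M + n).+2) / (1 - q) =
    1 - (q ^+ M.+1 - q ^+ (M + n).+1) / (1 - q) - q ^+ (M + n).+1.
    by rewrite [q ^+ (M + n).+2]exprS; field; rewrite gt_eqF.
  set x := q ^+ (M + n).+1 in x1 *; set d := (_ - x) / _.
  have d0 : 0 <= d.
    by rewrite divr_ge0 ?(ltW q1) // subr_ge0 ler_wiXn2l // ltnS leq_addr.
  have x0 : 0 <= x by rewrite exprn_ge0.
  by nra.
have decr m n : qpoch q q (m + n) <= qpoch q q m.
  elim: n => [|n IHn]; first by rewrite addn0.
  rewrite addnS qpochSr -exprS (le_trans _ IHn) // ler_piMr ?(ltW (qpoch_gt0 _)) //.
  by rewrite gerBl exprn_ge0.
exists (qpoch q q M / 2); first by rewrite divr_gt0 ?qpoch_gt0.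
move=> n; apply: le_trans (decr n M); rewrite addnC.
apply: le_trans (step n); rewrite ler_wpM2l ?(ltW (qpoch_gt0 _)) //.
have : (q ^+ M.+1 - q ^+ (M + n).+1) / (1 - q) <= 1 / 2.
  rewrite ler_pdivrMr // exprS.
  have : 0 <= q ^+ (M + n).+1 by rewrite exprn_ge0.
  have : q * q ^+ M <= 1 * q ^+ M by rewrite ler_wpM2r ?exprn_ge0.
  by lra.
by lra.
Qed.

(** Apart from the first one, the factors 1 - a q^i are at most
    1 + q^i <= 1 / (1 - q^i). *)
Lemma qpoch_neg_bound :
  exists2 B, 0 < B & forall a n, -1 <= a <= 0 -> 1 <= qpoch a q n <= B.
Proof.
have [c c0 hc] := qpoch_lower_bound.
exists (2 / c); first by rewrite divr_gt0.
move=> a n /andP[a1 a0].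
have a_ge k : 1 <= 1 - a * q ^+ k.
  by rewrite lerDl oppr_ge0 mulr_le0_ge0 ?exprn_ge0.
have ge1 m : 1 <= qpoch a q m.
  by elim: m => [|m IHm]; rewrite ?qpoch0 // qpochSr mulr_ege1.
rewrite ge1 /=.
have ub m : qpoch a q m.+1 <= 2 / qpoch q q m.
  elim: m => [|m IHm].
    by rewrite qpochSr !qpoch0 expr0 mulr1 mul1r divr1; lra.
  rewrite qpochSr; have := a_ge m.+1.
  rewrite [qpoch q q m.+1]qpochSr -exprS invfM mulrA => a2.
  apply: ler_pM => //; first exact: le_trans ler01 (ge1 _).
    exact: le_trans ler01 a2.
  have x1 := onem_expr_gt0 m.
  rewrite -[leRHS]mul1r ler_pdivlMr //.
  have x0 : 0 <= q ^+ m.+1 by rewrite exprn_ge0.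
  by nra.
case: n => [|n].
  rewrite qpoch0 ler_pdivlMr // mul1r (le_trans (hc 0%N)) // qpoch0.
  by rewrite ler1n.
apply: le_trans (ub n) _; rewrite ler_pM2l // lef_pV2 ?posrE //.
exact: qpoch_gt0.
Qed.

(** * Convergence to the value at x = -1 *)

Section Decay.
Variable r : R.
Hypotheses (q_lt_r : q < r) (r_lt1 : r < 1).

Let r_gt0 : 0 < r. Proof. exact: lt_trans q_lt_r. Qed.

(** A divided difference of x^i is 0 for i < n and lies in [0, 1] otherwise, so
    r^n / r^i bounds it in both cases.  Each factor 1 - q^(j+1) x of
    (qx; q)_M then multiplies a bound of this shape by 1 + q^(j+1) / r. *)
Lemma factorial_moment_bound n i M :
  `|factorial_moment n i M| <= qpoch (- (q / r)) q M * (r ^+ n / r ^+ i).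
Proof.
elim: M i => [|M IHM] i.
  rewrite qpoch0 mul1r factorial_moment0.
  have [le_ni|lt_in] := leqP n i; last first.
    by rewrite qdiff_monomial_small // normr0 divr_ge0 ?exprn_ge0 // ltW.
  have /andP[d0 d1] := qdiff_monomial_itv le_ni.
  rewrite ger0_norm // (le_trans d1) // ler_pdivlMr ?exprn_gt0 // mul1r.
  by rewrite ler_wiXn2l // ltW.
rewrite factorial_momentS (le_trans (ler_normB _ _)) // normrM.
rewrite [`|q ^+ _|]ger0_norm ?exprn_ge0 //.
apply: le_trans (lerD (IHM i) (ler_wpM2l (exprn_ge0 _ q_ge0) (IHM i.+1))) _.
rewrite le_eqVlt; apply/orP; left; apply/eqP.
rewrite qpochSr [r ^+ i.+1]exprS [q ^+ M.+1]exprS.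
have r0 : r != 0 by rewrite gt_eqF.
have ri : r ^+ i != 0 by rewrite expf_neq0.
by field; rewrite r0 ri.
Qed.

Lemma psi_sum_monomial_bound : exists2 A, 0 < A & forall N i,
  `|psi_sum N (fun k => q ^+ (k * i))| <= A * (r ^+ N / r ^+ i).
Proof.
have [c c0 hc] := qpoch_lower_bound.
have [B B0 hB] := qpoch_neg_bound.
exists (B / c); first by rewrite divr_gt0.
move=> N i; rewrite psi_sum_monomial normrM normfV.
rewrite [`|qpoch _ _ _|]gtr0_norm ?qpoch_gt0 //.
rewrite mulrAC; apply: ler_pM => //.
- by rewrite invr_ge0 ltW ?qpoch_gt0.
- apply: le_trans (factorial_moment_bound _ _ _) _.
  rewrite ler_wpM2r ?divr_ge0 ?exprn_ge0 ?(ltW r_gt0) //.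
  have /(hB _ N)/andP[] // : -1 <= - (q / r) <= 0.
  by rewrite lerN2 oppr_le0 divr_ge0 ?(ltW r_gt0) // ler_pdivrMr // mul1r ltW.
- by rewrite lef_pV2 ?posrE ?qpoch_gt0.
Qed.

(** The alternating sums of x^i f tend to (-1)^i v, with an error that is
    geometric in N and may grow like r^-i.  The uniformity in i is what makes
    the property stable under multiplication by power series in x. *)
Definition converges_to_evalm1 (f : nat -> R) (v : R) : Prop :=
  exists2 A, 0 <= A & forall N i,
  `|alt_sum N (fun k => q ^+ (k * i) * f k) - (-1) ^+ i * v|
    <= A * (r ^+ N / r ^+ i).

(** The error e_i for x^i satisfies |e_(i+1)| <= |e_i| + 2 A r^N / r^i, and
    the constant 2 A r / (1 - r) is a fixed point of the recursion this gives
    for the factor in front of r^N / r^i. *)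
Lemma converges_to_evalm1_one : converges_to_evalm1 (fun => 1) 1.
Proof.
have [A A0 hA] := psi_sum_monomial_bound.
exists (2 * A * r / (1 - r)).
  by rewrite divr_ge0 ?mulr_ge0 ?subr_ge0 // ltW.
move=> N i; rewrite mulr1.
rewrite (@eq_alt_sum _ _ (fun k => q ^+ (k * i))); last first.
  by move=> k; rewrite mulr1.
have r1 : 0 < 1 - r by rewrite subr_gt0.
elim: i => [|i IHi].
  rewrite (@eq_alt_sum _ _ (fun=> 1)); last by move=> k; rewrite muln0.
  rewrite alt_sum_one expr0 subrr normr0.
  by rewrite !(mulr_ge0, invr_ge0) // ?exprn_ge0 // ltW.
rewrite alt_sum_monomialS exprS.
set t := psi_sum _ _; set s := alt_sum _ _ in IHi *.
rewrite (_ : _ - _ = 2 * (-1) ^+ N * t - (s - (-1) ^+ i)); last by ring.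
apply: le_trans (ler_normB _ _) _.
have tA : `|2 * (-1) ^+ N * t| <= 2 * (A * (r ^+ N / r ^+ i)).
  rewrite !normrM normrX normrN1 expr1n mulr1 ger0_norm // ler_pM2l //.
  exact: hA.
apply: le_trans (lerD tA IHi) _.
rewrite le_eqVlt; apply/orP; left; apply/eqP; rewrite exprS.
have r0 : r != 0 by rewrite gt_eqF.
have ri : r ^+ i != 0 by rewrite expf_neq0.
by field; rewrite r0 ri gt_eqF.
Qed.

Lemma converges_to_evalm1_cvg f v : converges_to_evalm1 f v -> alt_sum ^~ f @ \oo --> v.
Proof.
move=> [A A0 hA]; apply/cvgrPdist_le => e e0.
have r_norm : `|r| < 1 by rewrite gtr0_norm.
have e1 : 0 < e / (A + 1) by rewrite divr_gt0 // ltr_wpDl.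
have /cvgr0Pnorm_le/(_ _ e1)[N0 _ h] := cvg_expr r_norm.
exists N0 => // N /h /=; rewrite ger0_norm ?exprn_ge0 ?(ltW r_gt0) // => rN.
rewrite distrC; have := hA N 0%N; rewrite expr0 mul1r divr1.
rewrite (@eq_alt_sum _ _ f) => [hN|k]; last by rewrite muln0 mul1r.
apply: le_trans hN _; apply: le_trans (ler_wpM2l A0 rN) _.
rewrite mulrCA ler_piMr ?(ltW e0) // ler_pdivrMr ?ltr_wpDl //.
by rewrite mul1r lerDl.
Qed.

Lemma cvg_alt_sum N (F : nat -> nat -> R) (G : nat -> R) :
  (forall k, F ^~ k @ \oo --> G k) ->
  alt_sum N (F J) @[J --> \oo] --> alt_sum N G.
Proof.
move=> FG; apply: cvgD; first exact: FG.
apply: cvgMl_tmp; apply: cvg_big => [|n _]; first exact: add_continuous.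
apply: cvgMl_tmp; apply: cvg_big => [|k _]; first exact: add_continuous.
by apply: cvgMl_tmp; apply: FG.
Qed.

Lemma alt_sum_sum N (c : nat -> R) (F : nat -> nat -> R) J :
  alt_sum N (fun k => \sum_(0 <= j < J) c j * F j k) =
  \sum_(0 <= j < J) c j * alt_sum N (F j).
Proof.
elim: J => [|J IHJ].
  rewrite big_geq // -[RHS](mul0r (alt_sum N (fun => 0))) -alt_sumZ.
  by apply: eq_alt_sum => k; rewrite big_geq // mul0r.
rewrite big_nat_recr //= -IHJ -alt_sumZ -alt_sumD; apply: eq_alt_sum => k.
by rewrite big_nat_recr.
Qed.

(** If g(x) = sum_j h_j x^j then x^i g f = sum_j h_j x^(i+j) f, and the errors
    add up to at most A (sum_j |h_j| / r^j) r^N / r^i. *)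
Lemma converges_to_evalm1_series (f : nat -> R) (v : R) (h g : nat -> R) (w : R) :
    converges_to_evalm1 f v ->
    (exists H, forall J, \sum_(0 <= j < J) `|h j| / r ^+ j <= H) ->
    (forall k, series (fun j => h j * q ^+ (k * j)) @ \oo --> g k) ->
    series (fun j => h j * (-1) ^+ j) @ \oo --> w ->
  converges_to_evalm1 (fun k => g k * f k) (w * v).
Proof.
move=> [A A0 hA] [H hH] hg hw.
have H0 : 0 <= H by rewrite (le_trans _ (hH 0%N)) // big_geq.
exists (A * H); first exact: mulr_ge0.
move=> N i.
pose F J k := q ^+ (k * i) * (series (fun j => h j * q ^+ (k * j)) J * f k).
have cvgF : alt_sum N (F J) - (-1) ^+ i * (series (fun j => h j * (-1) ^+ j) J * v)
    @[J --> \oo] -->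
    alt_sum N (fun k => q ^+ (k * i) * (g k * f k)) - (-1) ^+ i * (w * v).
  apply: cvgB; first by apply: cvg_alt_sum => k; apply: cvgMl_tmp; apply: cvgMr_tmp.
  by apply: cvgMl_tmp; apply: cvgMr_tmp.
apply: (cvgr_to_le (cvg_norm cvgF)); near=> J.
have -> : alt_sum N (F J) - (-1) ^+ i * (series (fun j => h j * (-1) ^+ j) J * v)
    = \sum_(0 <= j < J) h j *
      (alt_sum N (fun k => q ^+ (k * (i + j)) * f k) - (-1) ^+ (i + j) * v).
  rewrite /series /= mulr_suml mulr_sumr.
  rewrite (@eq_alt_sum _ _ (fun k => \sum_(0 <= j < J)
      h j * (q ^+ (k * (i + j)) * f k))).
    rewrite alt_sum_sum -sumrB; apply: eq_bigr => j _.
    by rewrite exprD; ring.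
  move=> k; rewrite /F /series /= mulr_suml mulr_sumr; apply: eq_bigr => j _.
  by rewrite mulnDr exprD; ring.
apply: le_trans (ler_norm_sum _ _ _) _.
apply: (@le_trans _ _ (\sum_(0 <= j < J) A * (r ^+ N / r ^+ i) * (`|h j| / r ^+ j))).
  apply: ler_sum => j _; rewrite normrM.
  apply: le_trans (ler_wpM2l (normr_ge0 _) (hA _ _)) _.
  by rewrite exprD invfM le_eqVlt; apply/orP; left; apply/eqP; ring.
rewrite -mulr_sumr [leRHS]mulrAC; apply: ler_wpM2l; last exact: hH.
by rewrite mulr_ge0 // divr_ge0 // exprn_ge0 // ltW.
Unshelve. all: by end_near. Qed.

End Decay.

(** * The q-binomial series *)

Definition qbin_coef (a : R) (j : nat) : R := qpoch a q j / qpoch q q j.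

Lemma qbin_coef0 a : qbin_coef a 0 = 1.
Proof. by rewrite /qbin_coef !qpoch0 divr1. Qed.

Lemma qbin_coefS a j :
  qbin_coef a j.+1 * (1 - q ^+ j.+1) = qbin_coef a j * (1 - a * q ^+ j).
Proof.
rewrite /qbin_coef !qpochSr -exprS.
have := qpoch_neq0 j; have : 1 - q ^+ j.+1 != 0 by rewrite gt_eqF ?onem_expr_gt0.
by move=> h1 h2; field; rewrite h1 h2.
Qed.

Lemma qbin_coef_bound : exists2 B, 0 < B &
  forall a j, -1 <= a <= 0 -> 0 <= qbin_coef a j <= B.
Proof.
have [c c0 hc] := qpoch_lower_bound; have [B B0 hB] := qpoch_neg_bound.
exists (B / c); first by rewrite divr_gt0.
move=> a j /(hB _ j)/andP[h1 h2].
have h0 := le_trans ler01 h1.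
rewrite divr_ge0 ?(ltW (qpoch_gt0 _)) //= ler_pM //.
  by rewrite invr_ge0 ltW ?qpoch_gt0.
by rewrite lef_pV2 ?posrE ?qpoch_gt0.
Qed.

Lemma geometric_partial_le (z : R) n :
  0 <= z -> z < 1 -> \sum_(0 <= j < n) z ^+ j <= (1 - z)^-1.
Proof.
move=> z0 z1; have d : 0 < 1 - z by rewrite subr_gt0.
rewrite -div1r ler_pdivlMr // mulrC big_mkord.
by rewrite -[X in _ <= X]/(1 : R) -opprB mulNr -subrX1 opprB gerBl exprn_ge0.
Qed.

Definition qbin_series (a x : R) : R := limn (series (fun j => qbin_coef a j * x ^+ j)).

Section QBinomial.
Variable a : R.
Hypothesis a_itv : -1 <= a <= 0.

Lemma qbin_coef_ge0 j : 0 <= qbin_coef a j.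
Proof. by have [B _ /(_ a j a_itv)/andP[]] := qbin_coef_bound. Qed.

Lemma qbin_series_cvg x :
  `|x| < 1 -> series (fun j => qbin_coef a j * x ^+ j) @ \oo --> qbin_series a x.
Proof.
move=> x1; have [B B0 hB] := qbin_coef_bound.
apply: normed_cvg; apply: (@series_le_cvg _ _ (geometric B `|x|)).
- by move=> n; apply: normr_ge0.
- by move=> n /=; rewrite mulr_ge0 ?exprn_ge0 // ltW.
- move=> n /=; have /andP[h0 h1] := hB a n a_itv.
  by rewrite normrM normrX ger0_norm // ler_wpM2r ?exprn_ge0.
- by apply: is_cvg_geometric_series; rewrite normr_id.
Qed.

(** The functional equation that characterises (ax; q)_oo / (x; q)_oo; it comes
    from the two-term recursion of the coefficients. *)
Lemma qbin_series_step x :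
  `|x| < 1 -> (1 - x) * qbin_series a x = (1 - a * x) * qbin_series a (x * q).
Proof.
move=> x1.
have xq1 : `|x * q| < 1.
  by rewrite normrM (ger0_norm q_ge0) (le_lt_trans _ x1) // ler_piMr.
have cx := qbin_series_cvg x1; have cxq := qbin_series_cvg xq1.
pose s y := series (fun j => qbin_coef a j * y ^+ j).
have sE n : s x n.+1 - s (x * q) n.+1 = x * s x n - a * x * s (x * q) n.
  rewrite /s /series /= !big_nat_recl //= !expr0 opprD addrACA subrr add0r.
  rewrite -sumrB !mulr_sumr -sumrB; apply: eq_bigr => j _.
  rewrite exprMn -mulrBr -[X in X - _]mulr1 -mulrBr mulrCA qbin_coefS.
  by rewrite [in RHS]exprMn exprS; ring.
have l1 : s x n.+1 - s (x * q) n.+1 @[n --> \oo] -->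
    qbin_series a x - qbin_series a (x * q).
  by apply: cvgB; rewrite cvg_shiftS.
have l2 : s x n.+1 - s (x * q) n.+1 @[n --> \oo] -->
    x * qbin_series a x - a * x * qbin_series a (x * q).
  rewrite (_ : (fun n => _) = (fun n => x * s x n - a * x * s (x * q) n)).
    by apply: cvgB; apply: cvgMl_tmp.
  by apply/funext => n; apply: sE.
have E : qbin_series a x - qbin_series a (x * q) =
    x * qbin_series a x - a * x * qbin_series a (x * q).
  exact: cvg_unique l1 l2.
move/eqP: E; rewrite -subr_eq0 => /eqP E.
by apply/eqP; rewrite -subr_eq0; apply/eqP; rewrite -[RHS]E; ring.
Qed.

Lemma norm_mul_expr x n : `|x| < 1 -> `|x * q ^+ n| < 1.
Proof.
move=> x1; rewrite normrM (le_lt_trans _ x1) // ler_piMr // ger0_norm ?exprn_ge0 //.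
by rewrite exprn_ile1.
Qed.

Lemma qbin_series_iter x n : `|x| < 1 ->
  qbin_series a x * qpoch x q n = qpoch (a * x) q n * qbin_series a (x * q ^+ n).
Proof.
move=> x1; elim: n => [|n IHn]; first by rewrite !qpoch0 expr0 !mulr1 mul1r.
rewrite !qpochSr mulrA IHn -mulrA -[in RHS]mulrA; congr (_ * _).
by rewrite mulrC qbin_series_step ?norm_mul_expr // exprSr !mulrA.
Qed.

Lemma qbin_series_near0 x : `|x| < 1 ->
  qbin_series a (x * q ^+ n) @[n --> \oo] --> (1 : R).
Proof.
move=> x1; have [B B0 hB] := qbin_coef_bound.
have d0 : 0 < 1 - `|x| by rewrite subr_gt0.
have bnd y : `|y| <= `|x| -> `|qbin_series a y - 1| <= B / (1 - `|x|) * `|y|.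
  move=> yx; have y1 := le_lt_trans yx x1.
  have cy : series (fun j => qbin_coef a j * y ^+ j) n.+1 - 1 @[n --> \oo]
      --> qbin_series a y - 1.
    by apply: cvgB; [rewrite cvg_shiftS; apply: qbin_series_cvg | exact: cvg_cst].
  apply: (cvgr_to_le (cvg_norm cy)); near=> n.
  rewrite /series /= big_nat_recl //= qbin_coef0 expr0 mulr1 addrAC subrr add0r.
  apply: le_trans (ler_norm_sum _ _ _) _.
  apply: (@le_trans _ _ (\sum_(0 <= j < n) B * `|y| * `|x| ^+ j)).
    apply: ler_sum => j _; have /andP[h0 h1] := hB a j.+1 a_itv.
    rewrite normrM (ger0_norm h0) normrX exprS mulrA.
    apply: (ler_pM (mulr_ge0 h0 (normr_ge0 y)) (exprn_ge0 j (normr_ge0 y))).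
      by rewrite ler_wpM2r.
    by rewrite lerXn2r ?nnegrE.
  rewrite -mulr_sumr [leRHS]mulrAC ler_wpM2l // ?mulr_ge0 // ?(ltW B0) //.
  by rewrite geometric_partial_le.
apply/cvgrPdist_le => e e0.
have q_norm : `|q| < 1 by rewrite ger0_norm.
set K := B / (1 - `|x|) in bnd.
have K0 : 0 <= K by rewrite divr_ge0 // ltW.
have e1 : 0 < e / (K + 1) by rewrite divr_gt0 // ltr_wpDl.
have /cvgr0Pnorm_le/(_ _ e1)[N0 _ h] := cvg_expr q_norm.
exists N0 => // N /h /= qN; rewrite distrC.
have hx : `|x * q ^+ N| <= `|x|.
  by rewrite normrM ler_piMr // ger0_norm ?exprn_ge0 // exprn_ile1.
apply: le_trans (bnd _ hx) _; rewrite normrM.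
have : `|x| * `|q ^+ N| <= e / (K + 1).
  by apply: le_trans qN; rewrite ler_piMl // ltW.
move=> /(ler_wpM2l K0) /le_trans; apply.
rewrite mulrCA ler_piMr ?(ltW e0) // ler_pdivrMr ?ltr_wpDl //.
by rewrite mul1r lerDl.
Unshelve. all: by end_near. Qed.

Lemma qbin_series_ge1 x : 0 <= x -> x < 1 -> 1 <= qbin_series a x.
Proof.
move=> x0 x1; have cx : `|x| < 1 by rewrite ger0_norm.
have := qbin_series_cvg cx; rewrite -cvg_shiftS => /cvgr_to_ge; apply.
near=> n; rewrite /series /= big_nat_recl //= qbin_coef0 expr0 mulr1 lerDl.
by apply: sumr_ge0 => j _; rewrite mulr_ge0 ?qbin_coef_ge0 // exprn_ge0.
Unshelve. all: by end_near. Qed.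

Lemma qpoch_aq_neq0 k : qpoch (a * q) q k != 0.
Proof.
have [B _ hB] := qpoch_neg_bound; case/andP: a_itv => a1 a0.
have /(hB _ k)/andP[h _] : -1 <= a * q <= 0.
  rewrite mulr_le0_ge0 // andbT.
  by apply: le_trans (ler_wpM2r q_ge0 a1); rewrite mulN1r lerN2.
by rewrite gt_eqF // (lt_le_trans ltr01).
Qed.

(** The value at x = -1 of the function of x = q^k equal to (q)_k / (aq)_k: by
    the q-binomial theorem that function is
    qbin_series a (qx) / qbin_series a q. *)
Definition qbin_ratio : R := qbin_series a (- q) / qbin_series a q.

Lemma converges_to_evalm1_qpoch r f v :
  q < r -> converges_to_evalm1 r f v ->
  converges_to_evalm1 r (fun k => qpoch q q k / qpoch (a * q) q k * f k)
    (qbin_ratio * v).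
Proof.
move=> qr fv; have r0 : 0 < r by exact: lt_trans qr.
have q_norm : `|q| < 1 by rewrite ger0_norm.
have F1 := qbin_series_ge1 q_ge0 q_lt1.
have F0 : 0 < qbin_series a q := lt_le_trans ltr01 F1.
apply: (@converges_to_evalm1_series r qr f v
  (fun j => qbin_coef a j * q ^+ j / qbin_series a q)
  (fun k => qpoch q q k / qpoch (a * q) q k) qbin_ratio) => //.
- have [B B0 hB] := qbin_coef_bound.
  exists (B / (1 - q / r)) => J.
  have z0 : 0 <= q / r by rewrite divr_ge0 // ltW.
  have z1 : q / r < 1 by rewrite ltr_pdivrMr // mul1r.
  apply: (@le_trans _ _ (\sum_(0 <= j < J) B * (q / r) ^+ j)).
    apply: ler_sum => j _; have /andP[h0 h1] := hB a j a_itv.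
    have qj : 0 <= q ^+ j by rewrite exprn_ge0.
    rewrite (ger0_norm (divr_ge0 (mulr_ge0 h0 qj) (ltW F0))) expr_div_n mulrA.
    rewrite ler_wpM2r ?invr_ge0 ?exprn_ge0 ?(ltW r0) //.
    rewrite ler_pdivrMr // -[leRHS]mulrA.
    by apply: (ler_pM h0 qj h1); rewrite ler_peMr.
  by rewrite -mulr_sumr ler_wpM2l ?(ltW B0) // geometric_partial_le.
- move=> k; have q1 : `|q * q ^+ k| < 1 by apply: norm_mul_expr.
  have -> : qpoch q q k / qpoch (a * q) q k =
      qbin_series a (q * q ^+ k) * (qbin_series a q)^-1.
    have Fn0 : qbin_series a q != 0 by rewrite gt_eqF.
    apply/eqP; rewrite (eqr_div _ _ (qpoch_aq_neq0 k) Fn0).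
    by apply/eqP; rewrite mulrC qbin_series_iter // mulrC.
  rewrite (_ : series _ = fun n =>
      series (fun j => qbin_coef a j * (q * q ^+ k) ^+ j) n * (qbin_series a q)^-1).
    by apply: cvgMr_tmp; apply: qbin_series_cvg.
  apply/funext => n; rewrite /series /= mulr_suml; apply: eq_bigr => j _.
  by rewrite exprMn -exprM; ring.
- rewrite (_ : series _ = fun n =>
      series (fun j => qbin_coef a j * (- q) ^+ j) n * (qbin_series a q)^-1).
    by apply: cvgMr_tmp; apply: qbin_series_cvg; rewrite normrN.
  apply/funext => n; rewrite /series /= mulr_suml; apply: eq_bigr => j _.
  by rewrite [(- q) ^+ j]exprNn; ring.
Qed.

End QBinomial.

(** In product form, (-x)_oo / (x)_oo * 1 / (-x)_oo = 1 / (x)_oo.  Both sides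
    multiplied by (x)_n depend only on values near 0, where every series tends
    to 1. *)
Lemma qbin_series_m1 x :
  `|x| < 1 -> qbin_series (-1) x * qbin_series 0 (- x) = qbin_series 0 x.
Proof.
move=> x1.
have i0 : -1 <= (0 : R) <= 0 by rewrite oppr_le0 ler01 lexx.
have i1 : -1 <= (-1 : R) <= 0 by rewrite lexx oppr_le0 ler01.
have nx1 : `|- x| < 1 by rewrite normrN.
have e0 n : qbin_series 0 x * qpoch x q n = qbin_series 0 (x * q ^+ n).
  by rewrite qbin_series_iter // mul0r qpoch_zero mul1r.
have e1 n : qbin_series 0 (- x) * qpoch (- x) q n = qbin_series 0 (- x * q ^+ n).
  by rewrite qbin_series_iter // mul0r qpoch_zero mul1r.
have e2 n : qbin_series (-1) x * qpoch x q n
    = qpoch (- x) q n * qbin_series (-1) (x * q ^+ n).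
  by rewrite qbin_series_iter // mulN1r.
have l0 := qbin_series_near0 i0 x1; have l1 := qbin_series_near0 i0 nx1.
have l2 := qbin_series_near0 i1 x1.
pose d := qbin_series (-1) x * qbin_series 0 (- x) - qbin_series 0 x.
have F0 : qbin_series 0 x != 0.
  apply/eqP => F0; move: l0.
  rewrite (_ : (fun n => _) = cst 0); last first.
    by apply/funext => n; rewrite -e0 F0 mul0r.
  move=> l0; have : (0 : R) = 1 by apply: cvg_unique (cvg_cst _) l0.
  by move/eqP; rewrite eq_sym oner_eq0.
have E n : d * qbin_series 0 (x * q ^+ n) = qbin_series 0 x *
   (qbin_series (-1) (x * q ^+ n) * qbin_series 0 (- x * q ^+ n)
    - qbin_series 0 (x * q ^+ n)).
  rewrite -e1 -e0 /d.
  (* Here (x)_n is distributed so that each series meets its own iteration. *)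
  rewrite [LHS](_ : _ = qbin_series 0 x * (qbin_series 0 (- x) *
    (qbin_series (-1) x * qpoch x q n) - qbin_series 0 x * qpoch x q n)); last by ring.
  by rewrite e2; ring.
have L1 : d * qbin_series 0 (x * q ^+ n) @[n --> \oo] --> d * 1.
  exact: cvgMl_tmp.
have L2 : d * qbin_series 0 (x * q ^+ n) @[n --> \oo] --> qbin_series 0 x * (1 * 1 - 1).
  rewrite (_ : (fun n => _) = (fun n => qbin_series 0 x *
   (qbin_series (-1) (x * q ^+ n) * qbin_series 0 (- x * q ^+ n)
    - qbin_series 0 (x * q ^+ n)))).
    by apply: cvgMl_tmp; apply: cvgB => //; apply: cvgM.
  by apply/funext => n; rewrite E.
have : d * 1 = qbin_series 0 x * (1 * 1 - 1) by apply: cvg_unique L1 L2.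
by rewrite !mulr1 subrr mulr0 => /eqP; rewrite subr_eq0 => /eqP.
Qed.

(** In product form, ((q)_oo / (-q)_oo)^2 is the square of (q)_oo / (-q)_oo;
    the two instances x = q and x = -q of the previous lemma suffice. *)
Lemma qbin_ratio_m1 : qbin_ratio (-1) = qbin_ratio 0 ^+ 2.
Proof.
have i0 : -1 <= (0 : R) <= 0 by rewrite oppr_le0 ler01 lexx.
have q_norm : `|q| < 1 by rewrite ger0_norm.
have Nq_norm : `|- q| < 1 by rewrite normrN.
have h1 := qbin_series_m1 q_norm; have h2 := qbin_series_m1 Nq_norm.
rewrite opprK in h2.
have F0 : qbin_series 0 q != 0.
  by rewrite gt_eqF // (lt_le_trans ltr01) // qbin_series_ge1.
have F1 : qbin_series 0 (- q) != 0.
  by apply: contra_neq F0 => F1; rewrite -h1 F1 mulr0.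
have -> : qbin_ratio (-1) = (qbin_series (-1) (- q) * qbin_series 0 q) *
   qbin_series 0 (- q) / (qbin_series 0 q * (qbin_series (-1) q * qbin_series 0 (- q))).
  rewrite /qbin_ratio; have G0 : qbin_series (-1) q != 0.
    by apply: contra_neq F0 => G0; rewrite -h1 G0 mul0r.
  by field; rewrite F0 F1 G0.
by rewrite h1 h2 /qbin_ratio expr_div_n.
Qed.

(** * The two instances, and the theta series *)

Let r := (1 + q) / 2.
Let q_lt_r : q < r. Proof. by have := q_lt1; rewrite /r; lra. Qed.
Let r_lt1 : r < 1. Proof. by have := q_lt1; rewrite /r; lra. Qed.

Lemma alt_sum_gauss : alt_sum ^~ (qpoch q q) @ \oo --> qbin_ratio 0.
Proof.
have i0 : -1 <= (0 : R) <= 0 by rewrite oppr_le0 ler01 lexx.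
have := converges_to_evalm1_qpoch i0 q_lt_r
  (converges_to_evalm1_one q_lt_r r_lt1).
rewrite mulr1 => /(converges_to_evalm1_cvg q_lt_r r_lt1).
rewrite (_ : (fun k => qpoch q q k / qpoch (0 * q) q k * 1) = qpoch q q) //.
by apply/funext => k; rewrite mul0r qpoch_zero divr1 mulr1.
Qed.

Lemma alt_sum_power m :
  alt_sum ^~ (fun k => (qpoch q q k / qpoch (- q) q k) ^+ m) @ \oo
    --> qbin_ratio 0 ^+ (2 * m).
Proof.
have i1 : -1 <= (-1 : R) <= 0 by rewrite lexx oppr_le0 ler01.
suff : converges_to_evalm1 r (fun k => (qpoch q q k / qpoch (- q) q k) ^+ m)
               (qbin_ratio (-1) ^+ m).
  by move=> /(converges_to_evalm1_cvg q_lt_r r_lt1); rewrite qbin_ratio_m1 -exprM.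
elim: m => [|m IHm]; first by rewrite expr0; apply: converges_to_evalm1_one.
have := converges_to_evalm1_qpoch i1 q_lt_r IHm.
rewrite -exprS mulN1r.
rewrite (_ : (fun k => qpoch q q k / qpoch (- q) q k *
    (qpoch q q k / qpoch (- q) q k) ^+ m) =
  (fun k => (qpoch q q k / qpoch (- q) q k) ^+ m.+1)) //.
by apply/funext => k; rewrite exprS.
Qed.

Lemma theta_nneg N :
  series (fun n : nat => (-1) ^ n%:Z * q ^ (n%:Z ^+ 2)) N.+1 =
  (alt_sum N (qpoch q q) + 1) / 2.
Proof.
rewrite /series /= big_ltn // expr0z mul1r expr0n expr0z.
rewrite /alt_sum qpoch0.
rewrite [X in 2 * X](_ : _ = \sum_(1 <= n < N.+1) (-1) ^ n%:Z * q ^ (n%:Z ^+ 2)).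
  by field.
apply: eq_big_nat => -[|n] // _; rewrite phi_sum_qpoch.
by rewrite (expr2 n.+1%:Z) -PoszM -!exprnP mulnn.
Qed.

Lemma theta_neg N :
  series (fun n : nat => (-1) ^ (- n.+1%:Z) * q ^ ((- n.+1%:Z) ^+ 2)) N =
  (alt_sum N (qpoch q q) - 1) / 2.
Proof.
rewrite /alt_sum qpoch0 big_add1 /=.
rewrite [X in 2 * X](_ : _ = \sum_(0 <= n < N)
   (-1) ^ (- n.+1%:Z) * q ^ ((- n.+1%:Z) ^+ 2)).
  by rewrite /series /=; field.
apply: eq_big_nat => n _; rewrite phi_sum_qpoch sqrrN -exprnN -exprVn invrN1.
by rewrite (expr2 n.+1%:Z) -PoszM -exprnP mulnn.
Qed.

End FixedBase.

(** The formula of Gauss: the ratio is (q)_oo / (-q)_oo. *)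
Lemma bilateral_theta (R : realType) (q : R) : 0 < q -> q < 1 ->
  bilateral_cvg (fun n : int => (-1) ^ n * q ^ (n ^+ 2)) /\
  bilateral_sum (fun n : int => (-1) ^ n * q ^ (n ^+ 2)) = qbin_ratio q 0.
Proof.
move=> q0 q1; have cg := alt_sum_gauss q0 q1.
have c1 : series (fun n : nat => (-1) ^ n%:Z * q ^ (n%:Z ^+ 2)) @ \oo
    --> (qbin_ratio q 0 + 1) / 2.
  rewrite -cvg_shiftS (_ : (fun n => _) = fun N => (alt_sum q N (qpoch q q) + 1) / 2).
    by apply: cvgMr_tmp; apply: cvgD => //; apply: cvg_cst.
  by apply/funext => N; rewrite /= theta_nneg.
have c2 : series (fun n : nat => (-1) ^ (- n.+1%:Z) * q ^ ((- n.+1%:Z) ^+ 2))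
    @ \oo --> (qbin_ratio q 0 - 1) / 2.
  rewrite (_ : series _ = fun N => (alt_sum q N (qpoch q q) - 1) / 2).
    by apply: cvgMr_tmp; apply: cvgB => //; apply: cvg_cst.
  by apply/funext => N; rewrite theta_neg.
split; first by split; [apply: cvgP c1 | apply: cvgP c2].
rewrite /bilateral_sum (cvg_lim _ c1) // (cvg_lim _ c2) //.
by field.
Qed.

Theorem proposition3p6 (R : realType) (m : nat) (q : R) (hq0 : 0 < q) (hq1 : q < 1) :
  [/\ bilateral_cvg (fun n : int => (-1) ^ n * q ^ (n ^+ 2)),
      cvgn (fun N : nat => \sum_(1 <= n < N)
        (-1) ^+ n * qhyper n [tuple of q ^+ n :: nseq m q]
                             [tuple of nseq m.+1 (- q)] q q)
    & bilateral_sum (fun n : int => (-1) ^ n * q ^ (n ^+ 2)) ^+ (2 * m + 2) =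
      1 + 2 * limn (fun N : nat => \sum_(1 <= n < N)
        (-1) ^+ n * qhyper n [tuple of q ^+ n :: nseq m q]
                             [tuple of nseq m.+1 (- q)] q q)].
Proof.
have hyperE n : qhyper n [tuple of q ^+ n :: nseq m q]
                         [tuple of nseq m.+1 (- q)] q q =
  phi_sum q n (fun k => (qpoch q q k / qpoch (- q) q k) ^+ m.+1).
  rewrite /qhyper /phi_sum; apply: eq_bigr => k _.
  rewrite /= !big_cons.
  have prod_nseq (x : R) l : \prod_(y <- nseq l x) qpoch y q k = qpoch x q k ^+ l.
    by elim: l => [|l IHl]; rewrite /= ?big_nil // big_cons IHl exprS.
  rewrite !prod_nseq /phi_coef expr_div_n !exprS.
  have c0 := qpoch_neq0 hq0 hq1 k.
  have d0 : qpoch (- q) q k != 0.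
    by rewrite -mulN1r qpoch_aq_neq0 // lexx oppr_le0 ler01.
  by field; rewrite c0 d0 expf_neq0.
have [bc ->] := bilateral_theta hq0 hq1.
have cl : (fun N : nat => \sum_(1 <= n < N)
    (-1) ^+ n * qhyper n [tuple of q ^+ n :: nseq m q]
                         [tuple of nseq m.+1 (- q)] q q) @ \oo -->
    (qbin_ratio q 0 ^+ (2 * m.+1) - 1) / 2.
  rewrite -cvg_shiftS (_ : [sequence _]_n = fun N => (alt_sum q N (fun k =>
      (qpoch q q k / qpoch (- q) q k) ^+ m.+1) - 1) / 2).
    apply: cvgMr_tmp; apply: cvgB; last exact: cvg_cst.
    exact: alt_sum_power.
  apply/funext => N /=; rewrite /alt_sum !qpoch0 divr1 expr1n.
  under eq_bigr do rewrite hyperE.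
  by field.
split=> //; first exact: cvgP cl.
rewrite (cvg_lim _ cl) // mulnS addnC.
by field.
Qed.
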